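(* For $\nu\ge0$, $\lambda\in[1/2,2]$ and $x>0$, $$\frac{I_{\nu-1}(x)}{I_\nu(x)}<B\Big(\nu-\lambda,\nu+\lambda,\sqrt{c_\nu^{(I)}(\lambda)},x\Big),\qquad\text{where}\qquad c_\nu^{(I)}(\lambda)=\frac{\nu+\lambda}{\nu-\lambda+2\sqrt{2\lambda}-1}.$$
   Context: $I_\nu$ denotes the modified Bessel function of the first kind of real order $\nu$, and $B(\alpha,\beta,\gamma,x)=\dfrac{\alpha+\sqrt{\beta^2+\gamma^2x^2}}{x}$. *)

(* Defs.v *)
(* World: Stdlib reals with Coquelicot. *)
From Stdlib Require Import Reals Factorial.
From Coquelicot Require Import Coquelicot.
Open Scope R_scope.

(* Reciprocal Gamma function 1/Γ(z), by the Euler–Gauss product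
     1/Γ(z) = lim_n z(z+1)...(z+n) / (n! n^z).
   The limit exists for every real z and vanishes exactly at the poles
   z = 0, -1, -2, ... of Γ, so no case distinction is needed there.
   The n = 0 term, in which Rpower 0 z = 1 is a junk value, does not affect
   the limit. *)
Definition rGamma (z : R) : R :=
  real (Lim_seq (fun n =>
    prod_f_R0 (fun k => z + INR k) n / (INR (fact n) * Rpower (INR n) z))).

(* Modified Bessel function of the first kind of real order nu, for x > 0:
     I_nu(x) = sum_(k >= 0) (x/2)^(2k+nu) / (k! Γ(k+nu+1)). *)
Definition BesselI (nu x : R) : R :=
  Series (fun k =>
    Rpower (x / 2) (2 * INR k + nu) * rGamma (INR k + nu + 1) / INR (fact k)).

Definition B (alpha beta gamma x : R) : R :=
  (alpha + sqrt (beta ^ 2 + gamma ^ 2 * x ^ 2)) / x.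

Definition cI (nu lambda : R) : R :=
  (nu + lambda) / (nu - lambda + 2 * sqrt (2 * lambda) - 1).

(* Main.v *)
Require Import Defs.
From Stdlib Require Import Reals Factorial Lra Lia.
From Coquelicot Require Import Coquelicot.
Open Scope R_scope.

(** Put z = x^2/4 and I_mu(x) = (x/2)^mu F_mu(z). Then F_mu is entire, positive
    for mu, z >= 0, and satisfies F_mu' = F_(mu+1) and
    F_(mu-1) = mu F_mu + z F_(mu+1); all of this follows from positivity of
    1/Γ and from 1/Γ(t) = t/Γ(t+1), which are read off Euler's product
    ([rGamma_pos], [rGamma_rec]). The claim becomes 2 F_(nu-1) < W F_nu, where
    W = nu - lambda + R, R = sqrt (p^2 + 4 c z) and p = nu + lambda.

    The quotient w = x I_(nu-1) / I_nu solves the Riccati equation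
    x w' = x^2 + 2 nu w - w^2, and w and W both tend to 2 nu at 0. Inserting W
    gives the defect, with s = sqrt (2 lambda),

      x W' - x^2 - 2 nu W + W^2 = (R - p) (p - (s-1) R)^2 / (p R) >= 0

    ([riccati_defect_square]): W is a supersolution, and the defect vanishes for
    at most one x > 0.

    The origin is a singular point of the equation, so the comparison is done
    there by hand. The function G = W F_nu - 2 F_(nu-1) satisfies the linear
    equation 2 z G' + W G = F_nu * defect and G(0) = 0. The explicit factor
    exp (R - p ln (R + p)) absorbs the nonconstant part of W, which leaves
    z K' + nu K = q with q >= 0 for K = exp (R - p ln (R + p)) G. Hence z^nu K
    increases strictly, and K(0) = 0 forces K > 0 ([singular_comparison]). *)

(** * The reciprocal Gamma function on the half-line z >= 0 *)

Definition euler_term (z : R) (n : nat) : R :=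
  prod_f_R0 (fun k => z + INR k) n / (INR (fact n) * Rpower (INR n) z).

(** Replacing n^z by (n+z+1)^z turns the decreasing Euler sequence into an
    increasing one with the same limit; for z > 0 its first term therefore
    bounds that limit away from 0. *)
Definition shifted_euler_term (z : R) (n : nat) : R :=
  prod_f_R0 (fun k => z + INR k) n
    / (INR (fact n) * Rpower (INR n + z + 1) z).

Lemma exp_mono (x y : R) : x <= y -> exp x <= exp y.
Proof.
  intros [H | ->]; [left; now apply exp_increasing | right; reflexivity].
Qed.

Lemma Rpower_pos (x y : R) : 0 < Rpower x y.
Proof. apply exp_pos. Qed.

Lemma ln_succ_le (y : R) : 0 < y -> ln (y + 1) - ln y <= / y.
Proof.
  intros Hy.
  replace (y + 1) with (y * (1 + / y)) by (field; lra).
  assert (0 < / y) by now apply Rinv_0_lt_compat.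
  rewrite ln_mult by lra.
  enough (ln (1 + / y) <= / y) by lra.
  rewrite <- (ln_exp (/ y)) at 2.
  apply ln_le; [lra | apply exp_ineq1_le].
Qed.

Lemma ln_succ_ge (y : R) : 0 < y -> / (y + 1) <= ln (y + 1) - ln y.
Proof.
  intros Hy.
  assert (0 < / (y + 1)) by (apply Rinv_0_lt_compat; lra).
  assert (Hq : 0 < y / (y + 1)) by (apply Rdiv_lt_0_compat; lra).
  assert (Hl : ln (y / (y + 1)) = ln y - ln (y + 1)) by (apply ln_div; lra).
  enough (ln (y / (y + 1)) <= - / (y + 1)) by lra.
  rewrite <- (ln_exp (- / (y + 1))).
  apply ln_le; [assumption |].
  replace (y / (y + 1)) with (1 + - / (y + 1)) by (field; lra).
  apply exp_ineq1_le.
Qed.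

(** This makes the Euler terms decrease: from n to n + 1 the power n^z in the
    denominator grows at least as much as the product of the factors 1 + z/k in
    the numerator. *)
Lemma Rpower_succ_ge (z y : R) :
  0 <= z -> 0 < y ->
  (1 + z / (y + 1)) * Rpower y z <= Rpower (y + 1) z.
Proof.
  intros Hz Hy.
  pose proof (ln_succ_ge y Hy) as Hl.
  unfold Rpower.
  replace (z * ln (y + 1)) with (z * (ln (y + 1) - ln y) + z * ln y) by ring.
  rewrite exp_plus.
  apply Rmult_le_compat_r; [left; apply exp_pos |].
  apply Rle_trans with (exp (z / (y + 1))); [apply exp_ineq1_le |].
  apply exp_mono; unfold Rdiv.
  now apply Rmult_le_compat_l.
Qed.

(** With y = n + z + 1 the factor y / (y - z) is 1 + z/(n+1), the one by which
    the numerator of an Euler term grows; hence the shift by z + 1 in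
    [shifted_euler_term]. *)
Lemma Rpower_succ_le (z y : R) :
  0 <= z -> z < y ->
  Rpower (y + 1) z <= y / (y - z) * Rpower y z.
Proof.
  intros Hz Hy.
  pose proof (ln_succ_le y ltac:(lra)) as Hl.
  unfold Rpower.
  replace (z * ln (y + 1)) with (z * (ln (y + 1) - ln y) + z * ln y) by ring.
  rewrite exp_plus.
  apply Rmult_le_compat_r; [left; apply exp_pos |].
  apply Rle_trans with (exp (z / y)).
  { apply exp_mono; unfold Rdiv; now apply Rmult_le_compat_l. }
  replace (y / (y - z)) with (/ (1 + - (z / y))) by (field; lra).
  rewrite <- (Ropp_involutive (z / y)) at 1.
  rewrite exp_Ropp.
  apply Rinv_le_contravar; [| apply exp_ineq1_le].
  replace (1 + - (z / y)) with ((y - z) / y) by (field; lra).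
  apply Rdiv_lt_0_compat; lra.
Qed.

Lemma rising_product_nonneg (z : R) (n : nat) :
  0 <= z -> 0 <= prod_f_R0 (fun k => z + INR k) n.
Proof.
  intros Hz; induction n as [| n IH]; cbn [prod_f_R0].
  - cbn; lra.
  - apply Rmult_le_pos; [assumption |].
    pose proof (pos_INR (S n)); lra.
Qed.

Lemma fact_pos (n : nat) : 0 < INR (fact n).
Proof. apply INR_fact_lt_0. Qed.

Lemma euler_term_decreasing (z : R) (n : nat) :
  0 <= z -> euler_term z (S (S n)) <= euler_term z (S n).
Proof.
  intros Hz; unfold euler_term.
  set (m := S n).
  change (fact (S m)) with (S m * fact m)%nat.
  cbn [prod_f_R0].
  rewrite mult_INR, S_INR.
  assert (Hm : 0 < INR m) by (apply lt_0_INR; unfold m; lia).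
  pose proof (rising_product_nonneg z m Hz) as HP.
  pose proof (fact_pos m) as Hf.
  pose proof (Rpower_succ_ge z (INR m) Hz Hm) as Hg.
  set (P := prod_f_R0 _ _) in *; set (f := INR (fact m)) in *.
  set (y := INR m) in *.
  pose proof (Rpower_pos y z) as Ha; pose proof (Rpower_pos (y + 1) z) as Hb.
  set (a := Rpower y z) in *; set (b := Rpower (y + 1) z) in *.
  assert (HPf : 0 <= P / f) by (apply Rdiv_le_0_compat; lra).
  replace (P * (z + (y + 1)) / ((y + 1) * f * b))
    with (P / f * ((1 + z / (y + 1)) * a / (a * b))) by (field; lra).
  replace (P / (f * a)) with (P / f * (b / (a * b))) by (field; lra).
  apply Rmult_le_compat_l; [assumption |].
  apply Rmult_le_compat_r; [left; apply Rinv_0_lt_compat; nra | assumption].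
Qed.

Lemma shifted_euler_term_increasing (z : R) (n : nat) :
  0 <= z -> shifted_euler_term z n <= shifted_euler_term z (S n).
Proof.
  intros Hz; unfold shifted_euler_term.
  change (fact (S n)) with (S n * fact n)%nat.
  cbn [prod_f_R0].
  rewrite mult_INR, S_INR.
  pose proof (pos_INR n) as Hn.
  pose proof (rising_product_nonneg z n Hz) as HP.
  pose proof (fact_pos n) as Hf.
  pose proof (Rpower_succ_le z (INR n + z + 1) Hz ltac:(lra)) as Hg.
  replace (INR n + 1 + z + 1) with (INR n + z + 1 + 1) by ring.
  set (P := prod_f_R0 _ _) in *; set (f := INR (fact n)) in *.
  set (m := INR n) in *; set (y := m + z + 1) in *.
  pose proof (Rpower_pos y z) as Ha; pose proof (Rpower_pos (y + 1) z) as Hb.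
  set (a := Rpower y z) in *; set (b := Rpower (y + 1) z) in *.
  assert (HPf : 0 <= P / f) by (apply Rdiv_le_0_compat; lra).
  replace (P * (z + (m + 1)) / ((m + 1) * f * b))
    with (P / f * (y / (y - z) * a / (a * b))) by (unfold y; field; lra).
  replace (P / (f * a)) with (P / f * (b / (a * b))) by (field; lra).
  apply Rmult_le_compat_l; [assumption |].
  apply Rmult_le_compat_r; [left; apply Rinv_0_lt_compat; nra | assumption].
Qed.

Lemma euler_term_lower_bound (z : R) (n : nat) :
  0 <= z -> z / Rpower (z + 1) z <= euler_term z (S n).
Proof.
  intros Hz.
  apply Rle_trans with (shifted_euler_term z (S n)).
  - assert (H0 : shifted_euler_term z 0 = z / Rpower (z + 1) z).
    { unfold shifted_euler_term; cbn [prod_f_R0 fact INR].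
      now rewrite Rplus_0_r, Rplus_0_l, Rmult_1_l. }
    rewrite <- H0.
    induction (S n) as [| m IH]; [apply Rle_refl |].
    eapply Rle_trans; [exact IH | now apply shifted_euler_term_increasing].
  - unfold shifted_euler_term, euler_term.
    apply Rmult_le_compat_l; [now apply rising_product_nonneg |].
    pose proof (fact_pos (S n)) as Hf.
    pose proof (Rpower_pos (INR (S n)) z) as Ha.
    apply Rinv_le_contravar; [now apply Rmult_lt_0_compat |].
    apply Rmult_le_compat_l; [lra |].
    apply Rle_Rpower_l; [assumption |].
    assert (0 < INR (S n)) by (apply lt_0_INR; lia).
    lra.
Qed.

Lemma euler_term_cv (z : R) :
  0 <= z -> is_lim_seq (euler_term z) (rGamma z).
Proof.
  intros Hz.
  assert (Hex : ex_finite_lim_seq (euler_term z)).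
  { destruct (ex_finite_lim_seq_decr (fun n => euler_term z (S n))
                (z / Rpower (z + 1) z)) as [l Hl];
      [intros n | intros n | exists l; now apply is_lim_seq_incr_1].
    - now apply euler_term_decreasing.
    - now apply euler_term_lower_bound. }
  apply Lim_seq_correct' in Hex.
  exact Hex.
Qed.

Lemma rGamma_pos (z : R) : 0 < z -> 0 < rGamma z.
Proof.
  intros Hz.
  apply Rlt_le_trans with (z / Rpower (z + 1) z).
  { apply Rdiv_lt_0_compat; [assumption | apply Rpower_pos]. }
  pose proof (euler_term_cv z ltac:(lra)) as Hcv.
  apply is_lim_seq_incr_1 in Hcv.
  exact (is_lim_seq_le _ _ _ _
           (fun n => euler_term_lower_bound z n (Rlt_le _ _ Hz))
           (is_lim_seq_const _) Hcv).
Qed.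

Lemma rising_product_shift (z : R) (n : nat) :
  z * prod_f_R0 (fun k => z + 1 + INR k) n
  = prod_f_R0 (fun k => z + INR k) (S n).
Proof.
  induction n as [| n IH].
  - cbn; ring.
  - change (prod_f_R0 (fun k => z + 1 + INR k) (S n))
      with (prod_f_R0 (fun k => z + 1 + INR k) n * (z + 1 + INR (S n))).
    rewrite <- Rmult_assoc, IH.
    change (prod_f_R0 (fun k => z + INR k) (S (S n)))
      with (prod_f_R0 (fun k => z + INR k) (S n) * (z + INR (S (S n)))).
    rewrite (S_INR (S n)); ring.
Qed.

(** The Euler terms satisfy the same equation up to the factor 1 + (z+1)/n,
    which tends to 1. *)
Lemma rGamma_rec (z : R) : 0 <= z -> rGamma z = z * rGamma (z + 1).
Proof.
  intros Hz.
  pose proof (euler_term_cv z Hz) as H0.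
  pose proof (euler_term_cv (z + 1) ltac:(lra)) as H1.
  apply is_lim_seq_incr_1 in H0; apply is_lim_seq_incr_1 in H1.
  apply (is_lim_seq_scal_l _ z) in H1.
  assert (Hinv : is_lim_seq (fun n => / INR (S n)) 0).
  { apply (is_lim_seq_incr_1 (fun n => / INR n)).
    apply (is_lim_seq_inv _ p_infty is_lim_seq_INR); discriminate. }
  assert (Hfac : is_lim_seq (fun n => 1 + (z + 1) * / INR (S n)) 1).
  { replace (Finite 1) with (Finite (1 + (z + 1) * 0)) by (f_equal; ring).
    apply is_lim_seq_plus'; [apply is_lim_seq_const |].
    apply is_lim_seq_mult'; [apply is_lim_seq_const | exact Hinv]. }
  pose proof (is_lim_seq_mult' _ _ _ _ H0 Hfac) as H2.
  rewrite Rmult_1_r in H2.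
  assert (E : forall n, euler_term z (S n) * (1 + (z + 1) * / INR (S n))
                        = z * euler_term (z + 1) (S n)).
  { intros n; unfold euler_term; set (m := S n).
    assert (Hm : 0 < INR m) by (apply lt_0_INR; unfold m; lia).
    unfold Rdiv at 2; rewrite <- Rmult_assoc, rising_product_shift.
    change (prod_f_R0 (fun k => z + INR k) (S m))
      with (prod_f_R0 (fun k => z + INR k) m * (z + INR (S m))).
    rewrite S_INR, Rpower_plus, Rpower_1 by assumption.
    pose proof (fact_pos m); pose proof (Rpower_pos (INR m) z).
    field; lra. }
  apply (is_lim_seq_ext _ _ _ E) in H2.
  apply is_lim_seq_unique in H1; apply is_lim_seq_unique in H2.
  rewrite H1 in H2; now injection H2.
Qed.

(** * The entire function behind the Bessel function *)

(** The Bessel function stripped of its power: I_mu(x) = (x/2)^mu F_mu(x^2/4),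
    with F_mu entire. In the variable z = x^2/4 differentiation only shifts the
    order. *)
Definition bessel_coef (mu : R) (k : nat) : R :=
  rGamma (INR k + mu + 1) / INR (fact k).

Definition bessel_entire (mu : R) : R -> R := PSeries (bessel_coef mu).

Lemma bessel_coef_pos (mu : R) (k : nat) : 0 <= mu -> 0 < bessel_coef mu k.
Proof.
  intros Hmu; apply Rdiv_lt_0_compat; [| apply fact_pos].
  apply rGamma_pos; pose proof (pos_INR k); lra.
Qed.

Lemma bessel_coef_derive (mu : R) (k : nat) :
  PS_derive (bessel_coef mu) k = bessel_coef (mu + 1) k.
Proof.
  unfold PS_derive, bessel_coef.
  change (fact (S k)) with (S k * fact k)%nat.
  rewrite mult_INR, S_INR.
  replace (INR k + 1 + mu + 1) with (INR k + (mu + 1) + 1) by ring.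
  pose proof (fact_pos k); pose proof (pos_INR k).
  field; lra.
Qed.

Lemma bessel_coef_ratio (mu : R) (k : nat) :
  0 <= mu ->
  bessel_coef mu (S k) / bessel_coef mu k
  = / (INR k + mu + 1) * / INR (S k).
Proof.
  intros Hmu.
  pose proof (pos_INR k) as Hk; pose proof (fact_pos k) as Hf.
  pose proof (rGamma_pos (INR k + mu + 1 + 1) ltac:(lra)) as Hg.
  unfold bessel_coef.
  change (fact (S k)) with (S k * fact k)%nat.
  rewrite mult_INR, (rGamma_rec (INR k + mu + 1)), !S_INR by lra.
  replace (INR k + 1 + mu + 1) with (INR k + mu + 1 + 1) by ring.
  field; repeat split; lra.
Qed.

Lemma bessel_coef_radius (mu : R) :
  0 <= mu -> CV_radius (bessel_coef mu) = p_infty.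
Proof.
  intros Hmu; apply CV_radius_infinite_DAlembert.
  - intros k; apply Rgt_not_eq, bessel_coef_pos; assumption.
  - apply is_lim_seq_le_le with (fun _ => 0) (fun k => / INR (S k)).
    + intros k; split; [apply Rabs_pos |].
      rewrite bessel_coef_ratio by assumption.
      pose proof (pos_INR k) as Hk.
      assert (HS : 0 < / INR (S k)) by (apply Rinv_0_lt_compat, lt_0_INR; lia).
      assert (H0 : 0 < / (INR k + mu + 1)) by (apply Rinv_0_lt_compat; lra).
      assert (H1 : / (INR k + mu + 1) <= / 1)
        by (apply Rinv_le_contravar; lra).
      rewrite Rinv_1 in H1.
      rewrite Rabs_pos_eq by nra.
      nra.
    + apply is_lim_seq_const.
    + apply (is_lim_seq_incr_1 (fun k => / INR k)).
      apply (is_lim_seq_inv _ p_infty is_lim_seq_INR); discriminate.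
Qed.

Lemma bessel_entire_derive (mu z : R) :
  0 <= mu -> is_derive (bessel_entire mu) z (bessel_entire (mu + 1) z).
Proof.
  intros Hmu; unfold bessel_entire.
  rewrite <- (PSeries_ext _ _ z (bessel_coef_derive mu)).
  apply is_derive_PSeries.
  now rewrite bessel_coef_radius.
Qed.

Lemma bessel_entire_ex (mu z : R) :
  0 <= mu -> ex_series (fun k => bessel_coef mu k * z ^ k).
Proof.
  intros Hmu; apply ex_pseries_R, CV_radius_inside.
  now rewrite bessel_coef_radius.
Qed.

Lemma bessel_entire_pos (mu z : R) : 0 <= mu -> 0 <= z -> 0 < bessel_entire mu z.
Proof.
  intros Hmu Hz.
  pose proof (bessel_entire_ex mu z Hmu) as Hex.
  unfold bessel_entire, PSeries.
  rewrite Series_incr_1 by assumption.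
  pose proof (bessel_coef_pos mu 0 Hmu) as H0.
  assert (Ht : 0 <= Series (fun k => bessel_coef mu (S k) * z ^ S k)).
  { rewrite <- (Rmult_0_l (Series (fun k => bessel_coef mu (S k) * z ^ S k))),
      <- Series_scal_l.
    apply Series_le; [intros k |].
    - rewrite Rmult_0_l; split; [lra |].
      apply Rmult_le_pos; [left; now apply bessel_coef_pos | now apply pow_le].
    - now apply (ex_series_incr_1 (fun k => bessel_coef mu k * z ^ k)). }
  simpl (z ^ 0); lra.
Qed.

(** Termwise this is 1/Γ(k+mu) = (k+mu)/Γ(k+mu+1); the factor k differentiates
    the series. *)
Lemma bessel_entire_contiguous (mu z : R) :
  0 <= mu ->
  bessel_entire (mu - 1) z
  = mu * bessel_entire mu z + z * bessel_entire (mu + 1) z.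
Proof.
  intros Hmu; unfold bessel_entire.
  rewrite <- PSeries_scal, <- PSeries_incr_1, <- PSeries_plus.
  - apply PSeries_ext; intros [| k].
    + change (bessel_coef (mu - 1) 0 = mu * bessel_coef mu 0 + 0).
      unfold bessel_coef; cbn [fact INR].
      replace (0 + (mu - 1) + 1) with mu by ring.
      rewrite rGamma_rec, Rplus_0_l by assumption; field.
    + change (bessel_coef (mu - 1) (S k)
              = mu * bessel_coef mu (S k) + bessel_coef (mu + 1) k).
      rewrite <- bessel_coef_derive.
      unfold PS_derive, bessel_coef.
      pose proof (pos_INR (S k)); pose proof (fact_pos (S k)).
      replace (INR (S k) + (mu - 1) + 1) with (INR (S k) + mu) by ring.
      rewrite (rGamma_rec (INR (S k) + mu)) by lra.
      field; lra.
  - apply ex_pseries_scal; [apply Rmult_comm |].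
    apply CV_radius_inside; now rewrite bessel_coef_radius.
  - apply CV_radius_inside.
    rewrite CV_radius_incr_1, bessel_coef_radius; [easy | lra].
Qed.

Lemma BesselI_bessel_entire (mu x : R) :
  0 < x -> BesselI mu x = Rpower (x / 2) mu * bessel_entire mu (x ^ 2 / 4).
Proof.
  intros Hx; unfold BesselI, bessel_entire, PSeries.
  rewrite <- Series_scal_l.
  apply Series_ext; intros k; unfold bessel_coef.
  replace (Rpower (x / 2) (2 * INR k + mu))
    with ((x ^ 2 / 4) ^ k * Rpower (x / 2) mu).
  { unfold Rdiv; ring. }
  rewrite Rpower_plus; f_equal.
  replace (x ^ 2 / 4) with ((x / 2) ^ 2) by field.
  rewrite <- pow_mult, <- Rpower_pow by lra.
  now rewrite mult_INR.
Qed.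

(** * A comparison principle at a singular point *)

Lemma derive_eta (f : R -> R) (x l : R) :
  is_derive f x l -> Derive (fun y : R => f y) x = l.
Proof. exact (is_derive_unique f x l). Qed.

(** Halving the interval gives two mean value points, and the derivative can
    vanish at no more than one of them. *)
Lemma strictly_increasing_of_derivative (H h : R -> R) :
  (forall z, 0 < z -> is_derive H z (h z)) ->
  (forall z, 0 < z -> 0 <= h z) ->
  (forall a b, 0 < a < b -> h a = 0 -> h b <> 0) ->
  forall a b, 0 < a < b -> H a < H b.
Proof.
  intros HD Hpos Hzero a b Hab.
  set (m := (a + b) / 2).
  assert (Hm : a < m < b) by (unfold m; lra).
  destruct (MVT_cor2 H h a m ltac:(lra)) as [c [Ec Hc]].
  { intros c Hc; apply is_derive_Reals, HD; lra. }
  destruct (MVT_cor2 H h m b ltac:(lra)) as [d [Ed Hd]].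
  { intros d Hd; apply is_derive_Reals, HD; lra. }
  pose proof (Hpos c ltac:(lra)) as Hhc.
  pose proof (Hpos d ltac:(lra)) as Hhd.
  pose proof (Hzero c d ltac:(lra)) as Hcd.
  destruct (Rle_lt_or_eq_dec _ _ Hhc) as [Hc' | Hc']; [nra |].
  destruct (Rle_lt_or_eq_dec _ _ Hhd) as [Hd' | Hd']; [nra |].
  exfalso; apply Hcd; congruence.
Qed.

(** The function z^nu K(z) has derivative z^(nu-1) q(z), hence increases. If K
    were nonpositive at y then K would be negative at y/2, and, as z^nu is
    nondecreasing, K would stay below that negative value all the way down to
    0, against K(0) = 0. *)
Lemma singular_comparison (nu : R) (K dK q : R -> R) :
  0 <= nu ->
  K 0 = 0 ->
  continuity_pt K 0 ->
  (forall z, 0 < z -> is_derive K z (dK z)) ->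
  (forall z, 0 < z -> z * dK z + nu * K z = q z) ->
  (forall z, 0 < z -> 0 <= q z) ->
  (forall a b, 0 < a < b -> q a = 0 -> q b <> 0) ->
  forall y, 0 < y -> 0 < K y.
Proof.
  intros Hnu HK0 Hcont HD Heq Hpos Hzero y Hy.
  assert (Hincr : forall a b, 0 < a < b ->
            Rpower a nu * K a < Rpower b nu * K b).
  { apply (strictly_increasing_of_derivative
             (fun z => Rpower z nu * K z) (fun z => Rpower z nu / z * q z)).
    - intros z Hz.
      rewrite <- Heq by assumption.
      pose proof (HD z Hz) as HDz.
      unfold Rpower; auto_derive.
      + repeat split; [assumption | now exists (dK z)].
      + rewrite (derive_eta K z _ HDz); field; lra.
    - intros z Hz; apply Rmult_le_pos; [| now apply Hpos].
      apply Rlt_le, Rdiv_lt_0_compat; [apply Rpower_pos | assumption].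
    - intros a b Hab Ha Hb.
      assert (Hne : forall z, 0 < z -> Rpower z nu / z <> 0).
      { intros z Hz; apply Rgt_not_eq, Rdiv_lt_0_compat;
          [apply Rpower_pos | assumption]. }
      apply Rmult_integral in Ha; apply Rmult_integral in Hb.
      destruct Ha as [Ha | Ha]; [now apply (Hne a) |].
      destruct Hb as [Hb | Hb]; [apply (Hne b); [lra | assumption] |].
      exact (Hzero a b Hab Ha Hb). }
  apply Rnot_le_lt; intros HKy.
  set (m := y / 2).
  assert (Hm : 0 < m < y) by (unfold m; lra).
  assert (HKm : K m < 0).
  { pose proof (Hincr m y Hm).
    pose proof (Rpower_pos m nu); pose proof (Rpower_pos y nu); nra. }
  destruct (Hcont (- K m) ltac:(lra)) as [d [Hd Hnear]].
  set (t := Rmin m d / 2).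
  assert (Ht : 0 < t < m /\ t < d).
  { unfold t; pose proof (Rmin_l m d); pose proof (Rmin_r m d).
    pose proof (Rmin_pos m d (proj1 Hm) Hd); lra. }
  assert (HKt : K t < K m).
  { pose proof (Hincr t m (proj1 Ht)) as Hlt.
    pose proof (Rpower_pos t nu) as Hpt.
    assert (Rpower t nu <= Rpower m nu) by (apply Rle_Rpower_l; lra).
    nra. }
  assert (Hdist : R_dist (K t) (K 0) < - K m).
  { apply Hnear; split; [split; [exact I | lra] |].
    cbn; unfold R_dist; rewrite Rabs_pos_eq; lra. }
  unfold R_dist in Hdist; rewrite HK0 in Hdist.
  apply Rabs_def2 in Hdist; lra.
Qed.

(** * The Riccati supersolution *)

(** With s^2 = 2 lambda and p = nu + lambda, r + p - s^2 is W and the left-hand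
    side is the defect x W' - x^2 - 2 nu W + W^2. Once 4 c z = r^2 - p^2 is
    substituted, r - p splits off and what remains is quadratic in r up to the
    denominator; with this c its discriminant vanishes, hence the square. *)
Lemma riccati_defect_square (p s c z r : R) :
  0 < p -> 0 < p - (s - 1) ^ 2 -> 0 < r ->
  c = p / (p - (s - 1) ^ 2) ->
  r ^ 2 = p ^ 2 + 4 * c * z ->
  2 * z * (2 * c / r - 2) + (r + p - s ^ 2) * (r - p)
  = (r - p) * (p - (s - 1) * r) ^ 2 / (p * r).
Proof.
  intros Hp Hden Hr Hc Hr2.
  assert (Hz : z = (r ^ 2 - p ^ 2) * (p - (s - 1) ^ 2) / (4 * p)).
  { rewrite Hr2, Hc; field; lra. }
  rewrite Hz, Hc; field; lra.
Qed.

(** Since R' = 2c/R, the logarithmic derivative of exp (R - p ln (R + p)) is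
    2c/(R+p) = (R-p)/(2z) = (W - 2 nu)/(2z). As an integrating factor it
    reduces the equation of G to that of [singular_comparison]. *)
Lemma bessel_entire_ratio_bound (nu lambda s c z : R) :
  0 <= nu -> 0 < lambda -> s ^ 2 = 2 * lambda ->
  0 < nu + lambda - (s - 1) ^ 2 ->
  c = (nu + lambda) / (nu + lambda - (s - 1) ^ 2) ->
  0 < z ->
  2 * bessel_entire (nu - 1) z
  < (nu - lambda + sqrt ((nu + lambda) ^ 2 + 4 * c * z)) * bessel_entire nu z.
Proof.
  intros Hnu Hlambda Hs Hden Hc Hz.
  set (p := nu + lambda) in *.
  assert (Hp : 0 < p) by (unfold p; lra).
  assert (Hcpos : 0 < c) by (rewrite Hc; now apply Rdiv_lt_0_compat).
  set (r := fun y => sqrt (p ^ 2 + 4 * c * y)).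
  set (F := bessel_entire nu); set (F1 := bessel_entire (nu + 1)).
  set (F2 := bessel_entire (nu + 1 + 1)).
  (* This is W F_nu - 2 F_(nu-1) with F_(nu-1) eliminated, so that only orders
     with positive coefficients and everywhere convergent series remain. *)
  set (G := fun y => (r y - p) * F y - 2 * y * F1 y).
  set (E := fun y => exp (r y - p * ln (r y + p))).
  enough (HK : 0 < E z * G z).
  { assert (HE : 0 < E z) by apply exp_pos.
    assert (HG : 0 < G z) by nra.
    rewrite bessel_entire_contiguous by assumption.
    fold F F1; change (sqrt (p ^ 2 + 4 * c * z)) with (r z).
    unfold G, p in HG; nra. }
  assert (Hrad : forall y, 0 <= y -> 0 < p ^ 2 + 4 * c * y).
  { intros y Hy; assert (0 < p ^ 2) by now apply pow_lt.
    assert (0 <= c * y) by (apply Rmult_le_pos; lra); lra. }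
  assert (Hr : forall y, 0 <= y -> 0 < r y).
  { intros y Hy; now apply sqrt_lt_R0, Hrad. }
  assert (Hr2 : forall y, 0 <= y -> r y ^ 2 = p ^ 2 + 4 * c * y).
  { intros y Hy; apply pow2_sqrt; left; now apply Hrad. }
  assert (Hr0 : r 0 = p).
  { unfold r; rewrite Rmult_0_r, Rplus_0_r; apply sqrt_pow2; lra. }
  assert (Hrincr : forall a b, 0 <= a < b -> r a < r b).
  { intros a b Hab; apply sqrt_lt_1;
      [left; apply Hrad; lra | left; apply Hrad; lra | nra]. }
  assert (HF : forall y, is_derive F y (F1 y)).
  { intros y; now apply bessel_entire_derive. }
  assert (HF1 : forall y, is_derive F1 y (F2 y)).
  { intros y; apply bessel_entire_derive; lra. }
  assert (Hode : forall y, F y = (nu + 1) * F1 y + y * F2 y).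
  { intros y; unfold F, F1, F2.
    rewrite <- bessel_entire_contiguous by lra; f_equal; ring. }
  assert (Hdr : forall y, 0 <= y -> is_derive r y (2 * c / r y)).
  { intros y Hy; pose proof (Hrad y Hy); pose proof (Hr y Hy) as Hry.
    unfold r in *; auto_derive; [lra |].
    replace (p * (p * 1)) with (p ^ 2) by ring.
    field; lra. }
  set (dG := fun y => 2 * c / r y * F y + (r y - p) * F1 y
                      - 2 * F1 y - 2 * y * F2 y).
  assert (HdG : forall y, 0 <= y -> is_derive G y (dG y)).
  { intros y Hy; unfold G, dG; auto_derive.
    - repeat split; [now exists (2 * c / r y); apply Hdr
                    | now exists (F1 y) | now exists (F2 y)].
    - rewrite (derive_eta r y _ (Hdr y Hy)),
        (derive_eta F y _ (HF y)),
        (derive_eta F1 y _ (HF1 y)); ring. }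
  assert (HdE : forall y, 0 <= y -> is_derive E y (E y * (2 * c / (r y + p)))).
  { intros y Hy; pose proof (Hr y Hy); unfold E; auto_derive.
    - repeat split; [now exists (2 * c / r y); apply Hdr
                    | now exists (2 * c / r y); apply Hdr | lra].
    - rewrite (derive_eta r y _ (Hdr y Hy)).
      unfold Rminus; field; lra. }
  set (dK := fun y => E y * (2 * c / (r y + p)) * G y + E y * dG y).
  assert (HdK : forall y, 0 <= y -> is_derive (fun y => E y * G y) y (dK y)).
  { intros y Hy; apply (is_derive_mult E G);
      [now apply HdE | now apply HdG | intros a b; apply Rmult_comm]. }
  assert (HFpos : forall y, 0 < y -> 0 < F y).
  { intros y Hy; apply bessel_entire_pos; lra. }
  apply (singular_comparison nu (fun y => E y * G y) dK
           (fun y => E y * F y / 2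
              * ((r y - p) * (p - (s - 1) * r y) ^ 2 / (p * r y)))).
  - assumption.
  - unfold G; rewrite Hr0; ring.
  - apply derivable_continuous_pt.
    exists (dK 0); apply is_derive_Reals, HdK; lra.
  - intros y Hy; apply HdK; lra.
  - intros y Hy.
    pose proof (Hr y ltac:(lra)) as Hry.
    pose proof (Hr2 y ltac:(lra)) as Hsq.
    rewrite <- (riccati_defect_square p s c y (r y)) by assumption.
    assert (Hphi : y * (2 * c / (r y + p)) = (r y - p) / 2).
    { replace (y * (2 * c / (r y + p))) with (4 * c * y / (2 * (r y + p)))
        by (field; lra).
      replace (4 * c * y) with (r y ^ 2 - p ^ 2) by lra.
      field; lra. }
    assert (HdGy : y * dG y = y * (2 * c / r y - 2) * F y
                              + (r y + p - s ^ 2) / 2 * ((r y - p) * F y - G y)).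
    { unfold dG, G; rewrite Hs, (Hode y); unfold p; field; lra. }
    unfold dK.
    transitivity (E y * (y * (2 * c / (r y + p)) * G y + y * dG y + nu * G y));
      [ring |].
    rewrite Hphi, HdGy, Hs; unfold p; field; lra.
  - intros y Hy.
    pose proof (Hr y ltac:(lra)) as Hry.
    pose proof (Hrincr 0 y ltac:(lra)) as Hpr; rewrite Hr0 in Hpr.
    pose proof (HFpos y Hy); pose proof (exp_pos (r y - p * ln (r y + p))).
    apply Rmult_le_pos.
    + apply Rlt_le, Rdiv_lt_0_compat; [now apply Rmult_lt_0_compat | lra].
    + apply Rdiv_le_0_compat; [| now apply Rmult_lt_0_compat].
      apply Rmult_le_pos; [lra | apply pow2_ge_0].
  - (* The square vanishes only where (s - 1) R = p, and R is injective. *)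
    assert (Hroot : forall y, 0 < y ->
      E y * F y / 2 * ((r y - p) * (p - (s - 1) * r y) ^ 2 / (p * r y)) = 0 ->
      p = (s - 1) * r y).
    { intros y Hy H0.
      pose proof (Hr y ltac:(lra)) as Hry.
      pose proof (Hrincr 0 y ltac:(lra)) as Hpr; rewrite Hr0 in Hpr.
      assert (Hpos : 0 < E y * F y / 2 * (r y - p) / (p * r y)).
      { apply Rdiv_lt_0_compat; [| now apply Rmult_lt_0_compat].
        apply Rmult_lt_0_compat; [| lra].
        apply Rdiv_lt_0_compat; [| lra].
        apply Rmult_lt_0_compat; [apply exp_pos | now apply HFpos]. }
      replace (E y * F y / 2 * ((r y - p) * (p - (s - 1) * r y) ^ 2 / (p * r y)))
        with (E y * F y / 2 * (r y - p) / (p * r y) * (p - (s - 1) * r y) ^ 2)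
        in H0 by (field; lra).
      apply Rmult_integral in H0; destruct H0 as [H0 | H0]; [lra |].
      nra. }
    intros a b Hab Ha Hb.
    apply Hroot in Ha; [| lra]; apply Hroot in Hb; [| lra].
    pose proof (Hrincr a b ltac:(lra)) as Hlt.
    assert (Hs1 : (s - 1) * (r b - r a) = 0) by lra.
    apply Rmult_integral in Hs1; destruct Hs1 as [Hs1 | Hs1]; [| lra].
    rewrite Hs1 in Ha; lra.
  - assumption.
Qed.

Theorem theorem8 (nu lambda x : R)
    (hnu : 0 <= nu) (hlambda : 1 / 2 <= lambda <= 2) (hx : 0 < x) :
  BesselI (nu - 1) x / BesselI nu x
    < B (nu - lambda) (nu + lambda) (sqrt (cI nu lambda)) x.
Proof.
  set (s := sqrt (2 * lambda)).
  assert (Hs2 : s ^ 2 = 2 * lambda) by (apply pow2_sqrt; lra).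
  assert (Hs1 : 1 <= s).
  { rewrite <- sqrt_1; apply sqrt_le_1_alt; lra. }
  assert (Hs4 : s <= 2) by nra.
  assert (Hden : 0 < nu + lambda - (s - 1) ^ 2) by nra.
  assert (Hc : cI nu lambda = (nu + lambda) / (nu + lambda - (s - 1) ^ 2)).
  { unfold cI; fold s; f_equal; nra. }
  assert (Hcpos : 0 < cI nu lambda).
  { rewrite Hc; apply Rdiv_lt_0_compat; lra. }
  assert (Hz : 0 < x ^ 2 / 4) by nra.
  pose proof (bessel_entire_ratio_bound nu lambda s (cI nu lambda) (x ^ 2 / 4)
                hnu ltac:(lra) Hs2 Hden Hc Hz) as Hb.
  pose proof (bessel_entire_pos nu (x ^ 2 / 4) hnu ltac:(lra)) as HF.
  rewrite !BesselI_bessel_entire by assumption.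
  unfold B; rewrite pow2_sqrt by lra.
  replace (4 * cI nu lambda * (x ^ 2 / 4)) with (cI nu lambda * x ^ 2) in Hb
    by field.
  set (W := nu - lambda + sqrt _) in *.
  set (F0 := bessel_entire (nu - 1) _) in *; set (F := bessel_entire nu _) in *.
  pose proof (Rpower_pos (x / 2) (nu - 1)) as HP.
  replace (Rpower (x / 2) nu) with (Rpower (x / 2) (nu - 1) * (x / 2)).
  2: { rewrite <- (Rpower_1 (x / 2)) at 2 by lra.
       rewrite <- Rpower_plus; f_equal; ring. }
  replace (Rpower (x / 2) (nu - 1) * F0 / (Rpower (x / 2) (nu - 1) * (x / 2) * F))
    with (2 * F0 / F / x) by (field; lra).
  apply Rmult_lt_compat_r; [now apply Rinv_0_lt_compat |].
  apply Rmult_lt_reg_r with F; [assumption |].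
  replace (2 * F0 / F * F) with (2 * F0) by (field; lra).
  assumption.
Qed.
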